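(* Let $G$ be a finite simple bipartite graph with non-empty edge set, let $K$ be a field and let $A(G)=K[E_G]/I(G)$ be the Eulerian Artinian algebra of $G$. Then $A(G)$ is Gorenstein if and only if $E_G$ does not possess any non-empty even cardinality Eulerian subset. If this is the case, then $I(G)=(t_e^2 : e\in E_G)$ and therefore $A(G)$ is a complete intersection.
   Context: $G$ is a finite simple undirected graph with vertex set $V_G$ and non-empty edge set $E_G$ (each edge is a 2-element subset of $V_G$); $K$ is any field. $K[E_G]=K[t_e : e\in E_G]$ is the standard graded polynomial ring. For $J\subseteq E_G$, $\mathbf{t}_J=\prod_{e\in J}t_e$. For $C\subseteq E_G$ and $v\in V_G$, $\deg_C(v)$ is the number of edges of $C$ containing $v$. $C$ is Eulerian if $\deg_C(v)$ is even for every $v\in V_G$. An Eulerian binomial is $\mathbf{t}_J-\mathbf{t}_L$ where $J,L\subseteq E_G$ are non-empty, $J\cap L=\emptyset$, $|J|=|L|$ and $J\cup L$ is Eulerian. $I(G)$ is the ideal of $K[E_G]$ generated by all Eulerian binomials and all $t_e^2$, $e\in E_G$; $A(G)=K[E_G]/I(G)$. A standard Artinian graded algebra $A$ over $K$ is Gorenstein if and only if its socle $\{u\in A : \mathfrak m u=0\}$ ($\mathfrak m$ the irrelevant ideal) is $1$-dimensional over $K$. *)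

(* Defs.v *)
From HB Require Import structures.
From mathcomp Require Import all_boot all_order all_algebra.
From mathcomp Require Import boolp.
From mathcomp.multinomials Require Import mpoly.

Set Implicit Arguments.
Unset Strict Implicit.
Unset Printing Implicit Defensive.

Import GRing.Theory.
Local Open Scope ring_scope.
Local Open Scope quotient_scope.

Section IdealGen.
Variable R : comNzRingType.
Implicit Types S : R -> Prop.

Definition ideal_gen S (x : R) : Prop :=
  exists2 s : seq (R * R),
    forall p, p \in s -> S p.2 & x = \sum_(p <- s) p.1 * p.2.

Lemma ideal_gen_sub S x : S x -> ideal_gen S x.
Proof.
move=> Sx; exists [:: (1, x)]; last by rewrite big_seq1 mul1r.
by move=> p; rewrite inE => /eqP->.
Qed.

Lemma ideal_gen0 S : ideal_gen S 0.
Proof. by exists [::]; rewrite ?big_nil. Qed.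

Lemma ideal_genMD S a u v :
  ideal_gen S u -> ideal_gen S v -> ideal_gen S (a * u + v).
Proof.
move=> [s Ss ->] [r Sr ->]; exists ([seq (a * p.1, p.2) | p <- s] ++ r).
  by move=> p; rewrite mem_cat => /orP[/mapP[q qs ->]|]; [exact: (Ss q) | exact: Sr].
rewrite big_cat big_map /=; congr (_ + _).
by rewrite mulr_sumr; apply: eq_bigr => p _; rewrite mulrA.
Qed.

Definition regular_sequence (fs : seq R) : Prop :=
  ~ ideal_gen (fun f => f \in fs) 1 /\
  forall i, (i < size fs)%N -> forall g : R,
    ideal_gen (fun f => f \in take i fs) (g * fs`_i) ->
    ideal_gen (fun f => f \in take i fs) g.

End IdealGen.

Section QuotientAlgebra.
Variables (K : fieldType) (R : comAlgType K) (I : idealr R).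

Definition quot_scale (c : K) (u : {ideal_quot I}) : {ideal_quot I} :=
  \pi_({ideal_quot I}) (c *: repr u).

Lemma quot_scaleE c u : quot_scale c u = \pi_({ideal_quot I}) c%:A * u.
Proof. by rewrite -[u in RHS]reprK -rmorphM /= mulr_algl. Qed.

Fact quot_scaleA a b u : quot_scale a (quot_scale b u) = quot_scale (a * b) u.
Proof. by rewrite !quot_scaleE mulrA -rmorphM /= mulr_algl scalerA. Qed.

Fact quot_scale1 : left_id 1 quot_scale.
Proof. by move=> u; rewrite quot_scaleE scale1r rmorph1 mul1r. Qed.

Fact quot_scaleDr : right_distributive quot_scale +%R.
Proof. by move=> a u v; rewrite !quot_scaleE mulrDr. Qed.

Fact quot_scaleDl u : {morph quot_scale^~ u : a b / a + b}.
Proof. by move=> a b; rewrite /= !quot_scaleE scalerDl rmorphD mulrDl. Qed.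

HB.instance Definition _ := GRing.Zmodule_isLmodule.Build K {ideal_quot I}
  quot_scaleA quot_scale1 quot_scaleDr quot_scaleDl.

Fact quot_scaleAl (a : K) (u v : {ideal_quot I}) : a *: (u * v) = a *: u * v.
Proof. by rewrite /GRing.scale /= !quot_scaleE mulrA. Qed.

HB.instance Definition _ :=
  GRing.Lmodule_isLalgebra.Build K {ideal_quot I} quot_scaleAl.
HB.instance Definition _ :=
  GRing.Lalgebra_isComAlgebra.Build K {ideal_quot I}.

End QuotientAlgebra.

Definition one_dimensional (K : fieldType) (V : lmodType K) (S : V -> Prop) :=
  exists2 u : V, u != 0 & forall v, S v <-> exists c : K, v = c *: u.

Section Socle.
Variables (K : fieldType) (A : comAlgType K) (m : A -> Prop).

Definition socle (u : A) : Prop := forall x, m x -> x * u = 0.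

(* Meaningful for a standard graded Artinian K-algebra A with irrelevant
   ideal m, for which it characterizes the Gorenstein property. *)
Definition artinian_gorenstein : Prop := one_dimensional socle.

End Socle.

(* Complete intersection property of the graded algebra K[t_1, ..., t_n] / I. *)
Definition complete_intersection (K : fieldType) (n : nat)
    (I : {mpoly K[n]} -> Prop) : Prop :=
  exists fs : seq {mpoly K[n]},
    [/\ forall f, f \in fs -> exists d, f \is d.-homog,
        regular_sequence fs
      & forall f, I f <-> ideal_gen (fun g => g \in fs) f].

Record sgraph := SGraph {
  vertex : finType;
  edges : {set {set vertex}};
  edges_card2 : forall e, e \in edges -> #|e| = 2
}.

Section Graph.
Variable G : sgraph.

Definition bipartite : Prop :=
  exists X : {set vertex G}, forall e, e \in edges G ->
    exists x y, [/\ x \in X, y \notin X & e = [set x; y]].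

Definition edge_deg (C : {set {set vertex G}}) (v : vertex G) : nat :=
  #|[set e in C | v \in e]|.

Definition eulerian (C : {set {set vertex G}}) : Prop :=
  forall v, ~~ odd (edge_deg C v).

Definition has_even_eulerian_subset : Prop :=
  exists C : {set {set vertex G}},
    [/\ C \subset edges G, C != set0, ~~ odd #|C| & eulerian C].

End Graph.

Section EulerianAlgebra.
Variables (K : fieldType) (G : sgraph).

(* The variable t_e is 'X_i for the index i such that e = enum_val i. *)
Local Notation P := {mpoly K[#|edges G|]}.

Definition edge_monomial (J : {set {set vertex G}}) : P :=
  \prod_(i < #|edges G| | enum_val i \in J) 'X_i.

Definition eulerian_binomial (f : P) : Prop :=
  exists J L : {set {set vertex G}},
    [/\ J \subset edges G /\ L \subset edges G,
        J != set0 /\ L != set0,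
        [disjoint J & L] /\ #|J| = #|L|,
        eulerian (J :|: L)
      & f = edge_monomial J - edge_monomial L].

Definition edge_square (f : P) : Prop := exists i, f = 'X_i ^+ 2.

Definition eulerian_ideal : P -> Prop :=
  ideal_gen (fun f => eulerian_binomial f \/ edge_square f).

Lemma edge_monomial_at0 (J : {set {set vertex G}}) :
  J \subset edges G -> J != set0 -> (edge_monomial J).@[fun=> 0] = 0.
Proof.
move=> sJ /set0Pn[e eJ]; have eE := subsetP sJ e eJ.
rewrite /edge_monomial (bigD1 (enum_rank_in eE e)) /=; last first.
  by rewrite enum_rankK_in.
by rewrite mevalM mevalXU mul0r.
Qed.

Lemma eulerian_ideal_at0 f : eulerian_ideal f -> f.@[fun=> 0] = 0.
Proof.
move=> [s Ss ->]; rewrite raddf_sum big1_seq // => p /andP[_ /Ss Sp] /=.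
rewrite mevalM; suff -> : (p.2).@[fun=> 0] = 0 by rewrite mulr0.
case: Sp => [[J [L [[sJ sL] [J0 L0] _ _ ->]]]|[i ->]].
  by rewrite mevalB !edge_monomial_at0 // subrr.
by rewrite expr2 mevalM mevalXU mul0r.
Qed.

(* MathComp quotients by boolean predicates. *)
Definition eulerian_idealb (f : P) : bool := `[< eulerian_ideal f >].

Fact eulerian_idealb_closed : idealr_closed eulerian_idealb.
Proof.
split.
- exact/asboolP/ideal_gen0.
- apply/asboolP => /eulerian_ideal_at0/eqP; rewrite meval1.
  by apply/negP; exact: oner_neq0.
- by move=> a u v /asboolP Iu /asboolP Iv; exact/asboolP/ideal_genMD.
Qed.

HB.instance Definition _ :=
  isIdealr.Build P eulerian_idealb eulerian_idealb_closed.

Definition eulerian_algebra : comAlgType K :=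
  {ideal_quot (eulerian_idealb : idealr P)}.

Definition eulerian_class (f : P) : eulerian_algebra :=
  \pi_({ideal_quot (eulerian_idealb : idealr P)}) f.

Definition eulerian_irrelevant : eulerian_algebra -> Prop :=
  ideal_gen (fun u => exists i, u = eulerian_class 'X_i).

Definition eulerian_gorenstein : Prop :=
  artinian_gorenstein eulerian_irrelevant.

End EulerianAlgebra.

(* Main.v *)
(* Call a set of edges tight if it has minimum size among the sets with the same
   odd degree vertices (a minimum T-join).  As the graph is bipartite, Eulerian
   sets are even, and the exchanges J <-> L show that a squarefree monomial is
   nonzero in A(G) exactly when it is tight, two of them being equal exactly when
   they have the same odd degree vertices.  Inclusion-maximal tight sets thus
   give socle elements, so if A(G) is Gorenstein every tight set extends to a
   tight set whose set of odd degree vertices is a fixed D.  Restrict to the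
   union of the Eulerian sets and choose vertices a, b minimizing the size of a
   T-join for T = D + {a, b}: every minimum D-join has exactly one edge at b.
   But b lies on two edges, which together form a tight set: a contradiction
   unless there is no Eulerian set.  Conversely, without Eulerian sets only the
   squares remain as generators, and the socle is spanned by the product of all
   variables. *)
From HB Require Import structures.
Require Import Defs.
From mathcomp Require Import all_boot all_order all_algebra.
From mathcomp Require Import boolp zify.
From mathcomp.multinomials Require Import mpoly.

Set Implicit Arguments.
Unset Strict Implicit.
Unset Printing Implicit Defensive.

(** * Symmetric difference as addition of sets modulo two *)

Section SymmetricDifference.
Variable T : finType.
Implicit Types A B C : {set T}.

Definition symdiff A B := (A :\: B) :|: (B :\: A).

Lemma in_symdiff A B x : (x \in symdiff A B) = (x \in A) (+) (x \in B).
Proof. by rewrite !inE; do 2 case: (x \in _). Qed.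

Lemma symdiffC A B : symdiff A B = symdiff B A.
Proof. by rewrite /symdiff setUC. Qed.

Lemma symdiffA A B C : symdiff A (symdiff B C) = symdiff (symdiff A B) C.
Proof. by apply/setP => x; rewrite !in_symdiff addbA. Qed.

Lemma symdiffv A : symdiff A A = set0.
Proof. by apply/setP => x; rewrite in_symdiff addbb inE. Qed.

Lemma symdiff0 A : symdiff A set0 = A.
Proof. by apply/setP => x; rewrite in_symdiff inE addbF. Qed.

Lemma symdiffK A B : symdiff A (symdiff A B) = B.
Proof. by rewrite symdiffA symdiffv symdiffC symdiff0. Qed.

Lemma symdiff_eq0 A B : (symdiff A B == set0) = (A == B).
Proof.
apply/eqP/eqP => [AB0|->]; last exact: symdiffv.
by rewrite -(symdiffK A B) AB0 symdiff0.
Qed.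

Lemma symdiff_sub A B C : A \subset C -> B \subset C -> symdiff A B \subset C.
Proof.
by move=> sA sB; rewrite subUset !(subset_trans (subsetDl _ _)).
Qed.

Lemma symdiff_disjoint A B : [disjoint A & B] -> symdiff A B = A :|: B.
Proof.
move=> /pred0P dAB; apply/setP => x; rewrite in_symdiff !inE.
by have /= := dAB x; do 2 case: (x \in _).
Qed.

Lemma symdiffD A B : B \subset A -> symdiff A B = A :\: B.
Proof. by rewrite /symdiff -setD_eq0 => /eqP->; rewrite setU0. Qed.

Lemma card_symdiff A B : #|symdiff A B| = #|A :\: B| + #|B :\: A|.
Proof.
rewrite /symdiff cardsU.
suff -> : (A :\: B) :&: (B :\: A) = set0 by rewrite cards0 subn0.
by apply/setP => x; rewrite !inE; do 2 case: (x \in _).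
Qed.

Lemma odd_card_symdiff A B : odd #|symdiff A B| = odd #|A| (+) odd #|B|.
Proof.
rewrite card_symdiff -(cardsID B A) -(cardsID A B) setIC !oddD.
by do 3 case: (odd _).
Qed.

End SymmetricDifference.

(** * Odd degree vertices and tight sets *)

Section Boundary.
Variable G : sgraph.
Local Notation V := (vertex G).
Implicit Types (A B C F J P Q R S : {set {set V}}) (e : {set V}).

Definition boundary S : {set V} := [set v | odd (edge_deg S v)].

Lemma eulerianP C : eulerian C <-> boundary C = set0.
Proof.
split=> [eC|/setP eC v]; last by have := eC v; rewrite !inE => ->.
by apply/setP => v; rewrite !inE (negbTE (eC v)).
Qed.

Lemma boundary_symdiff A B :
  boundary (symdiff A B) = symdiff (boundary A) (boundary B).
Proof.
apply/setP => v; rewrite in_symdiff !inE -odd_card_symdiff.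
congr (odd #|pred_of_set _|); apply/setP => e; rewrite in_symdiff !inE.
by do 2 case: (e \in _); case: (v \in e).
Qed.

Lemma boundary0 : boundary set0 = set0.
Proof. by have := boundary_symdiff set0 set0; rewrite !symdiffv. Qed.

Lemma boundary1 e : boundary [set e] = e.
Proof.
apply/setP => v; rewrite inE /edge_deg.
have [ve|nve] := boolP (v \in e).
  suff -> : [set f in [set e] | v \in f] = [set e] by rewrite cards1.
  by apply/setP => f; rewrite !inE; case: eqP => // ->.
suff -> : [set f in [set e] | v \in f] = set0 by rewrite cards0.
by apply/setP => f; rewrite !inE; case: eqP => // ->; apply/negbTE.
Qed.

Lemma sum_edge_deg P (U : {set V}) :
  \sum_(v in U) edge_deg P v = \sum_(e in P) #|e :&: U|.
Proof.
transitivity (\sum_(v in U) \sum_(e in P) (v \in e : nat)).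
  apply: eq_bigr => v _; rewrite /edge_deg -sum1_card big_mkcond [RHS]big_mkcond.
  by apply: eq_bigr => e _; rewrite !inE; case: (e \in P); case: (v \in e).
rewrite exchange_big; apply: eq_bigr => e _ /=.
rewrite -sum1_card big_mkcond [RHS]big_mkcond.
by apply: eq_bigr => v _; rewrite !inE; case: (v \in U); case: (v \in e).
Qed.

Lemma odd_sum_edge_deg P (U : {set V}) :
  odd (\sum_(v in U) edge_deg P v) = odd #|boundary P :&: U|.
Proof.
have -> : #|boundary P :&: U| = \sum_(v in U) odd (edge_deg P v).
  rewrite -sum1_card big_mkcond [RHS]big_mkcond; apply: eq_bigr => v _.
  by rewrite !inE andbC; case: (v \in U) => //=; case: odd.
by elim/big_rec2: _ => // v x y _ IH; rewrite !oddD IH oddb.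
Qed.

Lemma edge_at e v : e \in edges G -> v \in e ->
  exists2 w, w != v & e = symdiff [set v] [set w].
Proof.
move=> /edges_card2/eqP/cards2P[x [y [nxy ->]]]; rewrite !inE => /orP[]/eqP->.
  exists y; first by rewrite eq_sym.
  by rewrite symdiff_disjoint // disjoints1 inE.
by exists x => //; rewrite symdiff_disjoint ?disjoints1 ?inE 1?eq_sym // setUC.
Qed.

Lemma exists_edge_at S v : v \in boundary S -> exists2 e, e \in S & v \in e.
Proof.
rewrite inE /edge_deg.
have [->|/set0Pn[e]] := eqVneq [set e in S | v \in e] set0; first by rewrite cards0.
by rewrite inE => /andP[? ?]; exists e.
Qed.

(* The set [U] of the proof is the connected component of [a] in [P] minus the
   vertex [b]: if no edge of [P] joined it to [b], then [a] would be the only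
   odd degree vertex of this component. *)
Lemma path_from_boundary P a b : P \subset edges G -> a != b ->
    boundary P = symdiff [set a] [set b] ->
  exists Q, [/\ Q \subset P, boundary Q = boundary P & edge_deg Q b = 1].
Proof.
move=> sPE nab bP.
(* [Q] stands in for a path in [P] from [a] to [u] avoiding [b]; only its boundary is recorded, so
   closed parts are harmless. *)
pose conn u Q := [&& Q \subset P, b \notin cover Q
  & boundary Q == symdiff [set a] [set u]].
pose U := [set u | [exists Q, conn u Q]].
have aU : a \in U.
  rewrite inE; apply/existsP; exists set0; rewrite /conn sub0set boundary0.
  by rewrite /cover big_set0 inE symdiffv eqxx.
have bU : b \notin U.
  rewrite inE; apply/existsPn => Q; apply/and3P => -[_ bQ /eqP bdQ].
  have /exists_edge_at[e eQ be] : b \in boundary Q.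
    by rewrite bdQ in_symdiff !inE eqxx eq_sym (negbTE nab).
  by case/bigcupP: bQ; exists e.
have [/exists_inP[e eP /andP[be /set0Pn[c]]]|] :=
  boolP [exists e in P, (b \in e) && (e :&: U != set0)].
  rewrite !inE => /andP[ce /existsP[Q /and3P[sQP bQ /eqP bdQ]]].
  have nQ f : f \in Q -> b \notin f.
    by move=> fQ; apply: contra bQ => bf; apply/bigcupP; exists f.
  have neQ : e \notin Q by apply/negP => /nQ; rewrite be.
  have [w nwb De] := edge_at (subsetP sPE e eP) be.
  have Dw : w = c.
    have : c \in e by [].
    rewrite De in_symdiff !inE; case: (c =P w) => // _.
    rewrite addbF => /eqP cb; move: bU; rewrite -cb inE => /existsP[].
    by exists Q; rewrite /conn sQP bdQ bQ eqxx.
  exists (symdiff [set e] Q); split.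
  - by rewrite symdiff_sub // sub1set.
  - rewrite boundary_symdiff boundary1 bdQ bP De Dw.
    by apply/setP => x; rewrite !in_symdiff !inE; do 3 case: (x == _).
  rewrite /edge_deg; suff -> : [set f in symdiff [set e] Q | b \in f] = [set e].
    exact: cards1.
  apply/setP => f; rewrite inE in_symdiff inE.
  case: eqP => [->|_]; first by rewrite be (negbTE neQ).
  by rewrite /=; case: (boolP (f \in Q)) => // /nQ/negbTE.
move/exists_inPn => noU.
(* This sum is odd because [a] is the only vertex of [boundary P] in [U], yet even because each edge
   of [P] meets [U] in no vertex or in two. *)
suff : odd (\sum_(v in U) edge_deg P v) = false.
  rewrite odd_sum_edge_deg bP; suff -> : symdiff [set a] [set b] :&: U = [set a].
    by rewrite cards1.
  apply/setP => x; rewrite in_setI in_symdiff !in_set1.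
  case: (x =P a) => [->|_]; first by rewrite (negbTE nab) aU.
  by case: (x =P b) => [->|//]; rewrite (negbTE bU).
rewrite sum_edge_deg; elim/big_ind: _ => // [x y|e eP].
  by rewrite oddD => -> ->.
have [be|nbe] := boolP (b \in e).
  by have := noU e eP; rewrite be negbK => /eqP->; rewrite cards0.
have step x y : e = symdiff [set x] [set y] -> x \in U -> y \in U.
  rewrite !inE => De /existsP[Q /and3P[sQP bQ /eqP bdQ]]; apply/existsP.
  exists (symdiff Q [set e]); apply/and3P; split.
  - by rewrite symdiff_sub // sub1set.
  - apply: contra bQ => /bigcupP[f]; rewrite in_symdiff !inE.
    case: (f =P e) => [->|_]; first by rewrite (negbTE nbe).
    by rewrite addbF => fQ bf; apply/bigcupP; exists f.
  rewrite boundary_symdiff boundary1 bdQ De.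
  by apply/eqP/setP => z; rewrite !in_symdiff !inE; do 3 case: (z == _).
have [e0|/set0Pn[x]] := eqVneq (e :&: U) set0; first by rewrite e0 cards0.
rewrite inE => /andP[xe xU].
have [y nyx De] := edge_at (subsetP sPE e eP) xe.
have yU := step x y De xU.
suff /setIidPl-> : e \subset U by rewrite edges_card2 // (subsetP sPE).
apply/subsetP => z; rewrite De in_symdiff !inE => {De}.
by case: (z =P x) => [->|_]; [| case: (z =P y) => [->|]//]; move: xU yU; rewrite !inE.
Qed.

(* The tight sets are the minimum T-joins, for T the set of odd degree vertices. *)
Definition tight F S := (S \subset F) &&
  [forall S' : {set {set V}},
    (S' \subset F) && (boundary S' == boundary S) ==> (#|S| <= #|S'|)].

Lemma tightP F S : reflect
  (S \subset F /\ forall S', S' \subset F -> boundary S' = boundary S ->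
     #|S| <= #|S'|) (tight F S).
Proof.
apply: (iffP andP) => -[sS mS]; split=> //.
  by move=> S' sS' bS'; have /forallP/(_ S') := mS; rewrite sS' bS' eqxx.
by apply/forallP => S'; apply/implyP => /andP[sS' /eqP]; apply: mS.
Qed.

(** A competitor [J'] smaller than [J] would give the competitor [symdiff J' (S :\: J)] smaller than
    [S]. *)
Lemma tight_sub F S J : tight F S -> J \subset S -> tight F J.
Proof.
move=> /tightP[sS mS] sJS; apply/tightP; split; first exact: subset_trans sS.
move=> J' sJ' bJ'.
have := mS (symdiff J' (S :\: J)).
rewrite symdiff_sub ?(subset_trans (subsetDl _ _)) //.
rewrite boundary_symdiff bJ' -boundary_symdiff (symdiff_disjoint (A := J)); last first.
  by rewrite -setI_eq0; apply/eqP/setP => x; rewrite !inE; case: (x \in J).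
have -> : J :|: S :\: J = S by rewrite -{1}(setIidPr sJS) setID.
move=> /(_ isT erefl); rewrite card_symdiff.
have := subset_leq_card (subsetDl J' (S :\: J)).
have := subset_leq_card (subsetDl (S :\: J) J').
have := cardsID J S; rewrite (setIidPr sJS); lia.
Qed.

(** * Bipartite graphs: parity and the exchange argument *)

Hypothesis bipG : bipartite G.

(** Every edge has exactly one end in [X], so [#|C|] is the sum of the even degrees over [X]. *)
Lemma bipartite_eulerian_even C :
  C \subset edges G -> boundary C = set0 -> ~~ odd #|C|.
Proof.
move=> sC bC; have [X HX] := bipG.
have : odd (\sum_(v in X) edge_deg C v) = false.
  by rewrite odd_sum_edge_deg bC set0I cards0.
rewrite sum_edge_deg (eq_bigr (fun=> 1)) ?sum1_card => [->//|e eC].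
have [x [y [xX yX ->]]] := HX e (subsetP sC e eC).
suff -> : [set x; y] :&: X = [set x] by rewrite cards1.
apply/setP => z; rewrite !inE.
case: (z =P x) => [->|_] /=; first by rewrite xX.
by case: eqP => [->|]//=; apply/negbTE.
Qed.

Lemma odd_card_boundary A B : A \subset edges G -> B \subset edges G ->
  boundary A = boundary B -> odd #|A| = odd #|B|.
Proof.
move=> sA sB bAB.
have := @bipartite_eulerian_even (symdiff A B) (symdiff_sub sA sB).
rewrite boundary_symdiff bAB symdiffv odd_card_symdiff => /(_ erefl).
by do 2 case: odd.
Qed.

(** Parity leaves only the empty set as a smaller competitor, and its boundary would force
    [e = f]. *)
Lemma tight2 F e f : F \subset edges G -> e \in F -> f \in F -> e != f ->
  tight F [set e; f].
Proof.
move=> sF eF fF nef; have sef : [set e; f] \subset F.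
  by apply/subsetP => g; rewrite !inE => /orP[]/eqP->.
apply/tightP; split=> // S' sS' bS'.
have := odd_card_boundary (subset_trans sS' sF) (subset_trans sef sF) bS'.
rewrite cards2 nef; have [|] := ltnP #|S'| 2 => //.
case D: #|S'| => [|[|]] // _ _; move/eqP: D; rewrite cards_eq0 => /eqP D.
move: bS'; rewrite D boundary0 -symdiff_disjoint ?disjoints1 ?inE // boundary_symdiff.
by rewrite !boundary1 => /esym/eqP; rewrite symdiff_eq0 (negbTE nef).
Qed.

(* Let [S'] have minimum size among the edge sets whose boundary differs from
   [D] in at most two vertices [a], [b].  No edge of [S'] meets [b], and then
   every tight set with boundary [D] has exactly one edge at [b]: otherwise,
   swapping [S'] along a closed part of the symmetric difference produces
   another minimizer that meets [b]. *)
Lemma eulerian_cover_eq0 F D : F \subset edges G ->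
    (forall e, e \in F -> exists C, [/\ C \subset F, e \in C & boundary C = set0]) ->
    (forall J, tight F J -> exists R, [/\ tight F R, J \subset R & boundary R = D]) ->
  F = set0.
Proof.
move=> sF covF extF; apply/eqP/set0Pn => -[e0 e0F].
have other e v : e \in F -> v \in e -> exists f, [/\ f \in F, v \in f & e != f].
  move=> eF ve; have [C [sC eC /setP/(_ v)]] := covF e eF; rewrite !inE.
  move/negbT; rewrite /edge_deg (cardsD1 e) inE eC ve /= negbK => oC.
  have /set0Pn[f] : [set f in C | v \in f] :\ e != set0.
    by apply/eqP => C0; rewrite C0 cards0 in oC.
  rewrite !inE => /and3P[nfe fC vf]; exists f; split=> //; last by rewrite eq_sym.
  exact: (subsetP sC).
(* The case [a = b] is allowed; it describes the sets with boundary [D]. *)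
pose near S := (S \subset F) &&
  [exists a, exists b, boundary S == symdiff D (symdiff [set a] [set b])].
(* Extending a tight pair through [e0] yields a tight set [R0] with boundary [D]; deleting [e0] from
   it gives a smaller set in [near]. *)
have [f0 [f0F _ nef0]] : exists f, [/\ f \in F, true & e0 != f].
  have /eqP/cards2P[x [y [_ De0]]] := edges_card2 (subsetP sF e0 e0F).
  by have [|f []] := other e0 x e0F; [rewrite De0 !inE eqxx | exists f].
have [R0 [tR0 sR0 bR0]] := extF _ (tight2 sF e0F f0F nef0).
have sR0F : R0 \subset F by case/tightP: tR0.
have e0R0 : e0 \in R0 by apply: (subsetP sR0); rewrite !inE eqxx.
have drop S e : S \subset F -> e \in S ->
    boundary (S :\ e) = symdiff (boundary S) e /\ #|S :\ e| < #|S|.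
  move=> sS eS; split; last by rewrite [ltnRHS](cardsD1 e) eS.
  by rewrite -{2}(boundary1 e) -boundary_symdiff symdiffD // sub1set.
have near0 : near (R0 :\ e0).
  rewrite /near (subset_trans (subsetDl _ _) sR0F) (drop R0 e0 sR0F e0R0).1.
  have /eqP/cards2P[x [y [nxy De0]]] := edges_card2 (subsetP sF e0 e0F).
  apply/existsP; exists x; apply/existsP; exists y.
  by rewrite bR0 De0 (symdiff_disjoint (A := [set x])) // disjoints1 inE.
case: (arg_minnP (fun S => #|S|) near0) => S nS minS.
have ltS : #|S| < #|R0|.
  exact: leq_ltn_trans (minS _ near0) (drop R0 e0 sR0F e0R0).2.
case/andP: (nS) => sS /existsP[a /existsP[b /eqP bS]].
(* With [a = b], [S] would have boundary [D] and be smaller than the tight set [R0]. *)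
have nab : a != b.
  apply: contraL ltS => /eqP ab; rewrite -leqNgt.
  case/tightP: tR0 => _; apply => //.
  by rewrite bS ab symdiffv symdiff0.
(* Deleting an edge of [S1] at [b] moves [b] to the other end [w] and gives a smaller set in [near].
   A general [S1] is needed for the swapped set [symdiff S C] below. *)
have away S1 : S1 \subset F -> boundary S1 = boundary S -> #|S1| <= #|S| ->
    forall e, e \in S1 -> b \notin e.
  move=> sS1 bS1 leS1 e eS1; apply/negP => be.
  have [w _ De] := edge_at (subsetP sF e (subsetP sS1 e eS1)) be.
  have [bS1e ltS1] := drop S1 e sS1 eS1.
  have : near (S1 :\ e).
    rewrite /near (subset_trans (subsetDl _ _) sS1) bS1e bS1 bS De.
    apply/existsP; exists a; apply/existsP; exists w; apply/eqP/setP => x.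
    rewrite !in_symdiff !inE.
    by case: (x \in D); do 3 case: (x == _).
  by move/minS; rewrite leqNgt (leq_trans ltS1).
have bD : b \in D.
  have [|] := boolP (b \in boundary S).
    by case/exists_edge_at => e /(away S sS erefl (leqnn _) e) /negbTE->.
  rewrite bS !in_symdiff !inE eqxx (eq_sym b) (negbTE nab).
  by case: (b \in D).
have [e eR0 be] : exists2 e, e \in R0 & b \in e.
  by apply: exists_edge_at; rewrite bR0.
have eF := subsetP sR0F e eR0.
have [f [fF bf nef]] := other e b eF be.
have [R [/tightP[sR tR] sefR bR]] := extF _ (tight2 sF eF fF nef).
pose P := symdiff R S.
have sPF : P \subset F by exact: symdiff_sub.
have bP : boundary P = symdiff [set a] [set b].
  by rewrite boundary_symdiff bR bS symdiffK.
have [Q [sQP bQ dQ]] := path_from_boundary (subset_trans sPF sF) nab bP.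
have inP g : g \in [set e; f] -> g \in P.
  move=> gef; rewrite in_symdiff (subsetP sefR) //.
  have [/(away S sS erefl (leqnn _))|//] := boolP (g \in S).
  by move: gef; rewrite !inE => /orP[]/eqP->; rewrite ?be ?bf.
(* [Q] has a single edge at [b], whereas [e] and [f] both lie in [P]: one of them survives in the
   closed set [P :\: Q]. *)
have [g [gef gQ bg]] : exists g, [/\ g \in [set e; f], g \notin Q & b \in g].
  have [eQ|] := boolP (e \in Q); last by exists e; rewrite !inE eqxx.
  have [fQ|] := boolP (f \in Q); last by exists f; rewrite !inE eqxx orbT.
  have : [set e; f] \subset [set g in Q | b \in g].
    by apply/subsetP => g; rewrite !inE => /orP[]/eqP->; apply/andP.
  by move/subset_leq_card; rewrite [X in _ <= X]dQ cards2 nef.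
pose C := P :\: Q.
have bC : boundary C = set0 by rewrite /C -(symdiffD sQP) boundary_symdiff bQ symdiffv.
have sCF : C \subset F by apply: subset_trans sPF; exact: subsetDl.
have gC : g \in C by rewrite inE gQ inP.
have gS : g \notin S.
  by apply/negP => /(away S sS erefl (leqnn _)); rewrite bg.
have := away (symdiff S C) (symdiff_sub sS sCF).
rewrite boundary_symdiff bC symdiff0 => /(_ erefl).
have leR : #|R| <= #|symdiff R C|.
  by apply: tR; rewrite ?symdiff_sub // boundary_symdiff bC symdiff0.
suff -> : #|symdiff S C| <= #|S|.
  by move=> /(_ isT g); rewrite in_symdiff (negbTE gS) gC bg => /(_ isT).
(* As a subset of [symdiff R S], [C] splits into [C :&: R] and [C :&: S]. Tightness of [R] bounds
   the size of the first by that of the second, so swapping along [C] does not enlarge [S]. *)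
have CS : C :\: S = C :&: R.
  apply/setP => h; rewrite in_setI !in_setD in_symdiff.
  by case: (h \in R); case: (h \in S); rewrite ?andbF ?andbT.
have CR : C :\: R = C :&: S.
  apply/setP => h; rewrite in_setI !in_setD in_symdiff.
  by case: (h \in R); case: (h \in S); rewrite ?andbF ?andbT.
move: leR; rewrite !card_symdiff CS CR -(cardsID C R) -(cardsID C S).
by rewrite (setIC R) (setIC S) addnC leq_add2l addnC leq_add2r.
Qed.

End Boundary.

Import GRing.Theory.
Local Open Scope ring_scope.

(** * Generated ideals *)

Section GeneratedIdeal.
Variable R : comNzRingType.
Implicit Types (S : R -> Prop) (u v a : R).

Lemma ideal_genD S u v : ideal_gen S u -> ideal_gen S v -> ideal_gen S (u + v).
Proof. by move=> Su Sv; rewrite -[u]mul1r; apply: ideal_genMD. Qed.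

Lemma ideal_genM S a u : ideal_gen S u -> ideal_gen S (a * u).
Proof. by move=> Su; rewrite -[a * u]addr0; apply: ideal_genMD (ideal_gen0 S). Qed.

Lemma ideal_gen_sum S (I : eqType) (r : seq I) (F : I -> R) :
  (forall i, i \in r -> ideal_gen S (F i)) -> ideal_gen S (\sum_(i <- r) F i).
Proof.
move=> SF; rewrite big_seq; elim/big_ind: _ => //; first exact: ideal_gen0.
exact: ideal_genD.
Qed.

Lemma ideal_gen_mono S1 S2 u :
  (forall x, S1 x -> S2 x) -> ideal_gen S1 u -> ideal_gen S2 u.
Proof. by move=> S12 [s Ss ->]; exists s => // p /Ss/S12. Qed.

End GeneratedIdeal.

(** * Ideals generated by squares of variables *)

Section SquareIdeal.
Variables (K : fieldType) (n : nat).
Implicit Types (f g : {mpoly K[n]}) (k m : 'X_{1..n}) (A : pred 'I_n).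

Lemma mcoeff_mulX_eq0 f m k : ~~ (m <= k)%MM -> (f * 'X_[m])@_k = 0.
Proof.
move=> nmk; apply/eqP; rewrite mcoeff_eq0 (perm_mem (msuppMX f m)).
apply: contra nmk => /mapP[k' _ ->]; apply/mnm_lepP => i.
by rewrite mnmDE leq_addr.
Qed.

Lemma mpolyXU2 (i : 'I_n) : 'X_i ^+ 2 = 'X_[(U_(i) + U_(i))%MM] :> {mpoly K[n]}.
Proof. by rewrite expr2 mpolyXD. Qed.

Lemma square_dvd_mpolyX (S : {mpoly K[n]} -> Prop) i k :
  (1 < k i)%N -> S ('X_i ^+ 2) -> ideal_gen S 'X_[k].
Proof.
move=> ki Si; have le : (U_(i) + U_(i) <= k)%MM.
  by apply/mnm_lepP => j; rewrite mnmDE mnm1E; case: eqP => // <-.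
by rewrite -(submK le) mpolyXD -mpolyXU2; apply/ideal_genM/ideal_gen_sub.
Qed.

(** In a monomial ideal, each monomial of a member is divisible by some generator. The predicate [A]
    allows for initial segments of the sequence of squares. *)
Lemma square_idealP A f :
  ideal_gen (fun g => exists2 i, A i & g = 'X_i ^+ 2) f <->
  (forall k, (forall i, A i -> (k i <= 1)%N) -> f@_k = 0).
Proof.
split=> [[s Ss ->] k kA|f0].
  rewrite raddf_sum big1_seq //= => p /Ss[i Ai ->].
  rewrite mpolyXU2 mcoeff_mulX_eq0 //; apply/negP => /mnm_lepP/(_ i).
  by rewrite mnmDE mnm1E eqxx leqNgt ltnS kA.
rewrite [f]mpolyE; apply: ideal_gen_sum => k; rewrite mcoeff_msupp => fk.
rewrite -mul_mpolyC; apply: ideal_genM.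
have [i /andP[Ai ki]] : exists i, A i && (1 < k i)%N.
  apply/existsP; apply: contraNT fk => /existsPn kA; apply/eqP/f0 => i Ai.
  by have := kA i; rewrite Ai -leqNgt.
by apply: square_dvd_mpolyX ki _; exists i.
Qed.

Lemma squares_regular_sequence (s : seq 'I_n) : uniq s ->
  regular_sequence [seq 'X_i ^+ 2 : {mpoly K[n]} | i <- s].
Proof.
have memP t (g : {mpoly K[n]}) : ideal_gen (fun f => f \in [seq 'X_i ^+ 2 | i <- t]) g <->
    ideal_gen (fun f => exists2 i, i \in t & f = 'X_i ^+ 2) g.
  by split; apply: ideal_gen_mono => f /mapP.
move=> us; split.
  move/memP/square_idealP/(_ 0%MM); rewrite mcoeff1 eqxx => H.
  by have /eqP := H (fun i _ => ltac:(by rewrite mnm0E)); rewrite oner_eq0.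
move=> i; rewrite size_map => ltis g; rewrite -map_take => /memP/square_idealP gi.
have [x0 _] : exists x0 : 'I_n, true by case: s ltis {us gi} => // x0; exists x0.
apply/memP/square_idealP => k kt; pose x := nth x0 s i.
(* Multiplying by the square of ['X_x] raises exponents at [x] only, and [x] is not in [take i s] as
   [s] is [uniq]. *)
rewrite -(mcoeffMX g (U_(x) + U_(x))%MM) -mpolyXU2.
rewrite (nth_map x0) // in gi; apply: gi => j jt; rewrite !mnmDE !mnm1E.
suff /negbTE-> : x != j by rewrite kt.
apply: contraTneq jt => <-; move: (us); rewrite -{1}(cat_take_drop i s) cat_uniq.
by case/and3P=> _ /hasPn nts _; apply: nts; rewrite (drop_nth x0) // mem_head.
Qed.

End SquareIdeal.

(** * Squarefree monomials and a functional killing the ideal *)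

Section Monomials.
Variables (K : fieldType) (G : sgraph).
Local Notation V := (vertex G).
Local Notation E := (edges G).
Local Notation P := {mpoly K[#|E|]}.
Implicit Types (J L S : {set {set V}}).

Definition edge_mnm S : 'X_{1..#|E|} := [multinom (enum_val i \in S : nat) | i < #|E|].

Lemma edge_monomialE S : edge_monomial K S = 'X_[edge_mnm S].
Proof.
rewrite mpolyXE_id /edge_monomial big_mkcond; apply: eq_bigr => i _.
by rewrite mnmE; case: (_ \in S); rewrite ?expr1 ?expr0.
Qed.

Lemma edge_mnm_inj S S' : S \subset E -> S' \subset E ->
  edge_mnm S = edge_mnm S' -> S = S'.
Proof.
move=> sS sS' eSS'; apply/setP => e.
have [eE|neE] := boolP (e \in E); last first.
  by rewrite (negbTE (contra (subsetP sS e) neE)) (negbTE (contra (subsetP sS' e) neE)).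
have /mnmP/(_ (enum_rank_in eE e)) := eSS'; rewrite !mnmE enum_rankK_in //.
by do 2 case: (e \in _).
Qed.

Lemma edge_mnmU J L : [disjoint J & L] ->
  edge_mnm (J :|: L) = (edge_mnm J + edge_mnm L)%MM.
Proof.
move=> /pred0P dJL; apply/mnmP => i; rewrite mnmDE !mnmE inE.
by have /= := dJL (enum_val i); do 2 case: (_ \in _).
Qed.

(** The monomials of these sets agree modulo the ideal: those of distinct members [A] and [B] differ
    by a multiple of the binomial of [A :\: B] and [B :\: A]. *)
Definition edge_class S : {set {set {set V}}} :=
  [set S' : {set {set V}} | [&& S' \subset E, boundary S' == boundary S & #|S'| == #|S|]].

(* This functional kills [eulerian_ideal] when [S] is tight: Eulerian exchanges
   permute the monomials of [edge_class S]. *)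
Definition class_sum S (f : P) : K :=
  \sum_(k <- undup [seq edge_mnm S' | S' <- enum (edge_class S)]) f@_k.

Fact class_sum_linear S : linear (class_sum S : P -> K^o).
Proof.
move=> c f g; rewrite /class_sum scaler_sumr -big_split; apply: eq_bigr => k _.
by rewrite mcoeffD mcoeffZ.
Qed.

HB.instance Definition _ S :=
  GRing.isLinear.Build K P K^o _ (class_sum S) (class_sum_linear S).

Lemma class_sumZ S c f : class_sum S (c *: f) = c * class_sum S f.
Proof. exact: linearZ. Qed.

Lemma class_sumX S m :
  class_sum S 'X_[m] = (m \in [seq edge_mnm S' | S' <- enum (edge_class S)])%:R.
Proof.
rewrite /class_sum -mem_undup; set s := undup _; have us : uniq s := undup_uniq _.
have [ms|nms] := boolP (m \in s).
  rewrite (bigD1_seq m) //= mcoeffX eqxx big1 ?addr0 // => k /negbTE nkm.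
  by rewrite mcoeffX eq_sym nkm.
rewrite big1_seq // => k /andP[_ ks]; rewrite mcoeffX.
by case: eqP => // mk; rewrite mk ks in nms.
Qed.

Lemma class_sum_edge_monomial S S' : S' \subset E ->
  class_sum S (edge_monomial K S') = (S' \in edge_class S)%:R.
Proof.
move=> sS'; rewrite edge_monomialE class_sumX; congr (_ : bool)%:R.
apply/mapP/idP => [[S'' ]|S'S].
  rewrite mem_enum => S''S /edge_mnm_inj -> //.
  by move: S''S; rewrite inE => /andP[].
by exists S'; rewrite ?mem_enum.
Qed.

Lemma tight_class S S' : tight E S -> S' \in edge_class S -> tight E S'.
Proof.
move=> /tightP[sS mS]; rewrite inE => /and3P[sS' /eqP bS' /eqP cS'].
by apply/tightP; split=> // S1; rewrite cS' bS'; apply: mS.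
Qed.

(** The set [symdiff S (J :|: L)] has the boundary of [S] and [2 * #|S :&: L|] fewer edges, so
    tightness forces [S] and [L] to be disjoint. *)
Lemma tight_exchange S J L : tight E S -> J \subset S -> L \subset E ->
    [disjoint J & L] -> #|J| = #|L| -> boundary J = boundary L ->
  [disjoint S & L] /\ S :\: J :|: L \in edge_class S.
Proof.
move=> tS sJS sL dJL cJL bJL; have [sS mS] := tightP _ _ tS.
have sJ := subset_trans sJS sS.
have bC : boundary (J :|: L) = set0.
  by rewrite -symdiff_disjoint // boundary_symdiff bJL symdiffv.
have bSC : boundary (symdiff S (J :|: L)) = boundary S.
  by rewrite boundary_symdiff bC symdiff0.
have sSC : symdiff S (J :|: L) \subset E by rewrite symdiff_sub // subUset sJ.
have SC : S :\: (J :|: L) = (S :\: J) :\: L by rewrite setDDl.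
have CS : (J :|: L) :\: S = L :\: S.
  by rewrite setDUl; move: sJS; rewrite -setD_eq0 => /eqP->; rewrite set0U.
have SJL : (S :\: J) :&: L = S :&: L.
  apply/setP => x; rewrite !inE; have /pred0P/(_ x) /= := dJL.
  by do 3 case: (x \in _).
have dSL : [disjoint S & L].
  rewrite -setI_eq0 -cards_eq0; have := mS _ sSC bSC.
  rewrite card_symdiff SC CS.
  have := cardsID L (S :\: J); have := cardsID J S; have := cardsID S L.
  rewrite SJL (setIidPr sJS) (setIC L) cJL; clear; lia.
split=> //; have SCE : symdiff S (J :|: L) = S :\: J :|: L.
  rewrite /symdiff SC CS; move: dSL dJL; rewrite -!setI_eq0 => /eqP SL0 _.
  have -> : L :\: S = L by apply/setDidPl; rewrite disjoint_sym -setI_eq0 SL0.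
  by congr (_ :|: _); apply/setDidPl; rewrite -setI_eq0 SJL SL0.
rewrite -SCE inE sSC bSC eqxx /= SCE cardsU SJL.
move: dSL; rewrite -setI_eq0 => /eqP->; rewrite cards0 subn0.
by rewrite cardsD (setIidPr sJS) cJL subnK // -cJL subset_leq_card.
Qed.

Lemma class_sum_eulerian_ideal S (f : P) :
  tight E S -> eulerian_ideal f -> class_sum S f = 0.
Proof.
move=> tS [s Ss ->]; rewrite raddf_sum big1_seq //= => -[g h] /Ss /= Sh.
rewrite [g]mpolyE mulr_suml raddf_sum big1 //= => m _.
rewrite -scalerAl linearZ /=; case: Sh => [[J [L [[sJ sL] _ [dJL cJL] eJL ->]]]|[i ->]].
  have bJL : boundary J = boundary L.
    apply/eqP; rewrite -symdiff_eq0 -boundary_symdiff symdiff_disjoint //.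
    exact/eqP/eulerianP.
  rewrite mulrBr raddfB /= !edge_monomialE -!mpolyXD !class_sumX.
  suff : forall J L, J \subset E -> L \subset E -> [disjoint J & L] -> #|J| = #|L| ->
      boundary J = boundary L ->
      (m + edge_mnm J)%MM \in [seq edge_mnm S' | S' <- enum (edge_class S)] ->
      (m + edge_mnm L)%MM \in [seq edge_mnm S' | S' <- enum (edge_class S)].
    move=> H.
    suff -> : ((m + edge_mnm J)%MM \in [seq edge_mnm S' | S' <- enum (edge_class S)])
      = ((m + edge_mnm L)%MM \in [seq edge_mnm S' | S' <- enum (edge_class S)]).
      by rewrite subrr scaler0.
    by apply/idP/idP; apply: H => //; rewrite disjoint_sym.
  move=> {sJ sL dJL cJL eJL bJL}J {}L sJ sL dJL cJL bJL /mapP[S'].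
  rewrite mem_enum => S'S eS'.
  have tS' := tight_class tS S'S.
  have sJS' : J \subset S'.
    apply/subsetP => e eJ; have eE := subsetP sJ e eJ.
    have /mnmP/(_ (enum_rank_in eE e)) := eS'.
    by rewrite mnmDE !mnmE enum_rankK_in // eJ addn1; case: (e \in S').
  have [dSL S''S'] := tight_exchange tS' sJS' sL dJL cJL bJL.
  (* All exponents of [m + edge_mnm J] are at most one, so [m] is an indicator too, and the exchange
     applies to [S']. *)
  have -> : m = edge_mnm (S' :\: J).
    apply: (@addIm _ (edge_mnm J)); rewrite -edge_mnmU; last first.
      by rewrite -setI_eq0 setIDAC setDIl setDv setI0.
    by rewrite eS' setUC -{1}(setIidPr sJS') setID.
  rewrite -edge_mnmU; last exact: disjointWl (subsetDl _ _) dSL.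
  apply: map_f; rewrite mem_enum.
  move: S''S' S'S; rewrite !inE => /and3P[-> /eqP-> /eqP->].
  by case/and3P=> _ -> ->.
rewrite mpolyXU2 -mpolyXD class_sumX.
case: mapP => [[S' _ /mnmP/(_ i)]|_]; last by rewrite scaler0.
by rewrite !mnmDE mnm1E eqxx mnmE; case: (_ \in S'); lia.
Qed.

Lemma edge_monomial_notin_ideal S : tight E S -> ~ eulerian_ideal (edge_monomial K S).
Proof.
move=> tS /(class_sum_eulerian_ideal tS)/eqP; case/tightP: (tS) => sS _.
by rewrite class_sum_edge_monomial // inE sS !eqxx oner_eq0.
Qed.

End Monomials.

Lemma exists_subset_card (T : finType) (A : {set T}) k : (k <= #|A|)%N ->
  exists2 B : {set T}, B \subset A & #|B| = k.
Proof.
move=> kA; exists [set x in take k (enum A)].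
  by apply/subsetP => x; rewrite inE => /mem_take; rewrite mem_enum.
rewrite cardsE (card_uniqP _) ?take_uniq ?enum_uniq //.
by rewrite size_take -cardE; case: ltngtP kA.
Qed.

(** * The quotient algebra and its socle *)

Section EulerianQuotient.
Variables (K : fieldType) (G : sgraph).
Local Notation V := (vertex G).
Local Notation E := (edges G).
Local Notation P := {mpoly K[#|E|]}.
Local Notation I := (@eulerian_ideal K G).
Implicit Types (C J L S : {set {set V}}) (f g : P).

Lemma eulerian_class_eq f g : eulerian_class f = eulerian_class g <-> I (f - g).
Proof.
split=> [/eqP fg|Ifg]; last apply/eqP.
  by apply/asboolP; move: fg; rewrite -Quotient.idealrBE.
by rewrite -Quotient.idealrBE; apply/asboolP.
Qed.

Lemma eulerian_class0 f : eulerian_class f = 0 <-> I f.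
Proof.
rewrite -[f in I f]subr0; rewrite -eulerian_class_eq.
by rewrite /eulerian_class rmorph0.
Qed.

Lemma eulerian_classM f g :
  eulerian_class (f * g) = eulerian_class f * eulerian_class g.
Proof. exact: rmorphM. Qed.

Lemma eulerian_classZ c f : eulerian_class (c *: f) = c *: eulerian_class f.
Proof. by rewrite [RHS]quot_scaleE -[c *: f]mulr_algl; apply: rmorphM. Qed.

Lemma eulerian_class_surj (u : eulerian_algebra K G) : exists f, u = eulerian_class f.
Proof.
by exists (generic_quotient.repr u); rewrite /eulerian_class generic_quotient.reprK.
Qed.

Lemma socle_eulerian_class f :
  socle (@eulerian_irrelevant K G) (eulerian_class f) <-> forall i, I ('X_i * f).
Proof.
split=> [sf i|If x [s Ss ->]].
  apply/eulerian_class0; rewrite eulerian_classM; apply: sf.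
  by apply: ideal_gen_sub; exists i.
rewrite mulr_suml big1_seq // => p /andP[_ /Ss[i ->]].
by rewrite -mulrA -eulerian_classM (eulerian_class0 _).2 ?mulr0.
Qed.

Lemma edge_monomial_nonsquarefree J L x : x \in E -> x \in J -> x \in L ->
  I (edge_monomial K J * edge_monomial K L).
Proof.
move=> xE xJ xL; rewrite !edge_monomialE -mpolyXD.
apply: (@square_dvd_mpolyX _ _ _ (enum_rank_in xE x)).
  by rewrite mnmDE !mnmE enum_rankK_in // xJ xL.
by right; exists (enum_rank_in xE x).
Qed.

Lemma edge_monomialU J L : [disjoint J & L] ->
  edge_monomial K (J :|: L) = edge_monomial K J * edge_monomial K L.
Proof. by move=> dJL; rewrite !edge_monomialE edge_mnmU // mpolyXD. Qed.

Lemma mpolyX_edge_monomial i : 'X_i = edge_monomial K [set enum_val i] :> P.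
Proof.
rewrite edge_monomialE; congr 'X_[_]; apply/mnmP => j.
by rewrite mnm1E mnmE inE (inj_eq enum_val_inj) eq_sym.
Qed.

Hypothesis bipG : bipartite G.

(* If [S'] has the boundary of [S] and fewer edges, more than half of the
   Eulerian set [symdiff S S'] lies in [S]; exchanging half of it inside [S]
   for the other half creates a repeated edge. *)
Lemma not_tight_ideal S : S \subset E -> ~~ tight E S -> I (edge_monomial K S).
Proof.
move=> sS; rewrite /tight sS => /forallPn[S'].
rewrite negb_imply -ltnNge => /andP[/andP[sS' /eqP bS'] ltS].
have oSS' := odd_card_boundary bipG sS sS' (esym bS').
pose A := S :\: S'; pose B := S' :\: S.
have cA : (#|A| + #|S :&: S'| = #|S|)%N by rewrite addnC cardsID.
have cB : (#|B| + #|S :&: S'| = #|S'|)%N by rewrite addnC setIC cardsID.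
(* [k] is half of [#|symdiff S S'|], an integer by parity; the bounds come from [#|B| < #|A|]. *)
have [k [kA kB kAB]] :
    exists k, [/\ (k <= #|A|)%N, (#|B| < k)%N & (k + k = #|A| + #|B|)%N].
  exists ((#|A| + #|B|)./2).
  have : odd (#|A| + #|B|) = false.
    by move: oSS'; rewrite -cA -cB !oddD; do 3 case: odd.
  move: cA cB ltS; clear; move: #|A| #|B| #|_ :&: _| #|S| #|S'| => a b c s s' *.
  by split; lia.
have [J sJA cJ] := exists_subset_card kA.
pose L := symdiff S S' :\: J.
have sJC : J \subset symdiff S S'.
  by apply: subset_trans sJA _; apply: subsetUl.
have dJL : [disjoint J & L] by rewrite -setI_eq0 setIDA setIC -setIDA setDv setI0.
have JL : J :|: L = symdiff S S' by rewrite -{1}(setIidPr sJC) setID.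
have cL : #|L| = k.
  have := cardsID J (symdiff S S'); rewrite (setIidPr sJC) card_symdiff cJ -/L -/A -/B.
  by rewrite -kAB => /addnI.
have sC : symdiff S S' \subset E by exact: symdiff_sub.
have sJ : J \subset E := subset_trans sJC sC.
have sL : L \subset E := subset_trans (subsetDl _ _) sC.
have sJS : J \subset S by apply: subset_trans sJA (subsetDl _ _).
have dSJ : [disjoint S :\: J & J] by rewrite -setI_eq0 setIDAC -setIDA setDv setI0.
have DS : S = S :\: J :|: J by rewrite setUC -{1}(setIidPr sJS) setID.
(* [L] has more than [#|B|] edges, so one of them lies in [A] but not in [J]: the edge repeated
   between [S :\: J] and [L]. *)
have [x xL xB] : exists2 x, x \in L & x \notin B.
  by apply/subsetPn; apply: contraL kB => /subset_leq_card; rewrite cL -leqNgt.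
have xSJ : x \in S :\: J.
  move: xL xB; rewrite !in_setD in_symdiff.
  by case: (x \in S); case: (x \in S'); rewrite ?andbF.
rewrite {1}DS edge_monomialU //.
(* The monomial of [S] is a multiple of the binomial of [J] and [L] plus the product of the
   monomials of [S :\: J] and [L]. *)
rewrite -[X in I X](subrK (edge_monomial K (S :\: J) * edge_monomial K L)) -mulrBr.
apply: ideal_genD; last first.
  exact: edge_monomial_nonsquarefree (subsetP sL x xL) xSJ xL.
apply: ideal_genM; apply: ideal_gen_sub; left; exists J, L; split=> //.
- by rewrite -!card_gt0 cJ cL; split; apply: leq_ltn_trans kB.
- by rewrite cJ cL.
by apply/eulerianP; rewrite JL boundary_symdiff bS' symdiffv.
Qed.

(** The variable of an edge of [S] creates a square; for any other edge, maximality makes the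
    enlarged set non-tight, so its monomial vanishes. *)
Lemma socle_maxset_tight S : maxset (tight E) S ->
  socle (@eulerian_irrelevant K G) (eulerian_class (edge_monomial K S)).
Proof.
move=> /maxsetP[tS mS]; apply/socle_eulerian_class => i.
have [sS _] := tightP _ _ tS.
rewrite mpolyX_edge_monomial; have [iS|niS] := boolP (enum_val i \in S).
  by apply: edge_monomial_nonsquarefree (enum_valP i) _ iS; rewrite inE.
rewrite -edge_monomialU ?disjoints1 //; apply: not_tight_ideal.
  by rewrite subUset sub1set enum_valP.
apply: contra niS => tiS; rewrite -(mS _ tiS (subsetUr _ _)).
by rewrite !inE eqxx.
Qed.

(** Both monomials are non-zero multiples of the socle generator, hence proportional. If the
    boundaries differed, [class_sum S] would vanish on the monomial of [S'] but not on that of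
    [S]. *)
Lemma gorenstein_boundary S S' : eulerian_gorenstein K G ->
  maxset (tight E) S -> maxset (tight E) S' -> boundary S' = boundary S.
Proof.
move=> [u u0 soc] mS mS'.
have [tS _] := maxsetP mS; have [tS' _] := maxsetP mS'.
have [c Dc] := (soc _).1 (socle_maxset_tight mS).
have [c' Dc'] := (soc _).1 (socle_maxset_tight mS').
have nz S1 d : tight E S1 -> eulerian_class (edge_monomial K S1) = d *: u -> d != 0.
  move=> tS1 Dd; apply/eqP => d0; apply: (@edge_monomial_notin_ideal K _ _ tS1).
  by apply/eulerian_class0; rewrite Dd d0 scale0r.
have : I (c' *: edge_monomial K S - c *: edge_monomial K S').
  by apply/eulerian_class_eq; rewrite !eulerian_classZ Dc Dc' !scalerA mulrC.
move/(class_sum_eulerian_ideal tS)/eqP; rewrite raddfB /= !class_sumZ.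
have [[sS _] [sS' _]] := (tightP _ _ tS, tightP _ _ tS').
rewrite !class_sum_edge_monomial // [S \in _]inE sS !eqxx /= mulr1.
have [|_] := boolP (S' \in edge_class S); first by rewrite inE => /and3P[_ /eqP].
by rewrite mulr0 subr0 (negbTE (nz _ _ tS' Dc')).
Qed.

(** [eulerian_cover_eq0] is applied to the union [F] of all Eulerian sets. Tight sets in [F] are
    tight in [E], and the fixed boundary is that of [R0 :&: F] for a maximal tight [R0]. *)
Lemma gorenstein_acyclic C : eulerian_gorenstein K G ->
  C \subset E -> boundary C = set0 -> C = set0.
Proof.
move=> gorG sC bC.
pose F := \bigcup_(C : {set {set V}} | (C \subset E) && (boundary C == set0)) C.
have sF : F \subset E by apply/bigcupsP => C' /andP[].
have closedF C' : C' \subset E -> boundary C' = set0 -> C' \subset F.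
  by move=> sC' bC'; apply: bigcup_sup; rewrite sC' bC' eqxx.
suff F0 : F = set0 by apply/eqP; rewrite -subset0 -F0 closedF.
have eqF S S' : S \subset F -> S' \subset E -> boundary S' = boundary S -> S' \subset F.
  move=> sS sS' bS'; rewrite -(symdiffK S S'); apply: symdiff_sub => //.
  apply: closedF; first by rewrite symdiff_sub // (subset_trans sS).
  by rewrite boundary_symdiff bS' symdiffv.
have tF S : tight F S -> tight E S.
  move=> /tightP[sS mS]; apply/tightP; split; first exact: subset_trans sF.
  by move=> S' sS' bS'; apply: mS => //; apply: eqF bS'.
have t0 : tight E set0.
  by apply/tightP; split=> [|S' _ _]; rewrite ?sub0set // cards0.
have [R0 mR0 _] := maxset_exists t0.
have [tR0 _] := maxsetP mR0; have [sR0 _] := tightP _ _ tR0.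
apply: (@eulerian_cover_eq0 _ bipG F (boundary (R0 :&: F)) sF).
  move=> e /bigcupP[C' /andP[sC' /eqP bC'] eC'].
  by exists C'; split=> //; apply: closedF.
move=> J tJ; have [R mR sJR] := maxset_exists (tF J tJ).
have [tR _] := maxsetP mR; have [sR _] := tightP _ _ tR.
have bR := gorenstein_boundary gorG mR0 mR.
have tRF := tight_sub tR (subsetIl R F).
have [_ mRF] := tightP _ _ tRF.
exists (R :&: F); split.
- apply/tightP; split; first exact: subsetIr.
  by move=> S' sS'; apply: mRF; apply: subset_trans sF.
- by rewrite subsetI sJR; case/tightP: tJ.
(* [R] and [R0] have equal boundaries, so their symmetric difference is Eulerian and intersecting it
   with [F] changes nothing. *)
apply/eqP; rewrite -symdiff_eq0 -boundary_symdiff.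
have -> : symdiff (R :&: F) (R0 :&: F) = symdiff R R0 :&: F.
  apply/setP => e; rewrite in_setI !in_symdiff !in_setI.
  by case: (e \in F); rewrite ?andbT ?andbF.
suff /setIidPl-> : symdiff R R0 \subset F by rewrite boundary_symdiff bR symdiffv.
by apply: closedF; rewrite ?symdiff_sub // boundary_symdiff bR symdiffv.
Qed.

Lemma gorenstein_no_even_eulerian :
  eulerian_gorenstein K G -> ~ has_even_eulerian_subset G.
Proof.
move=> gorG [C [sC C0 _ /eulerianP bC]].
by move: C0; rewrite (gorenstein_acyclic gorG sC bC) eqxx.
Qed.

End EulerianQuotient.

(** * Graphs without even Eulerian sets *)

Section NoEulerian.
Variables (K : fieldType) (G : sgraph).
Local Notation E := (edges G).
Local Notation P := {mpoly K[#|E|]}.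
Hypothesis noC : ~ has_even_eulerian_subset G.

(** A binomial generator would provide the non-empty Eulerian set [J :|: L], whose size
    [#|J| + #|L|] is even. *)
Lemma eulerian_ideal_squares (f : P) :
  eulerian_ideal f <-> ideal_gen (@edge_square K G) f.
Proof.
split; apply: ideal_gen_mono => g; last by right.
case=> // -[J [L [[sJ sL] [J0 _] [dJL cJL] eJL _]]]; case: noC.
exists (J :|: L); split=> //.
- by rewrite subUset sJ.
- by apply: contra J0; rewrite setU_eq0 => /andP[].
by rewrite -symdiff_disjoint // odd_card_symdiff cJL addbb.
Qed.

Lemma eulerian_idealP (f : P) : eulerian_ideal f <->
  forall k : 'X_{1..#|E|}, (forall i, (k i <= 1)%N) -> f@_k = 0.
Proof.
rewrite eulerian_ideal_squares; split=> [sf k k1|f0].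
  have /(square_idealP xpredT) :
      ideal_gen (fun g : P => exists2 i, xpredT i & g = 'X_i ^+ 2) f.
    by apply: ideal_gen_mono sf => g [i ->]; exists i.
  by apply.
apply: (@ideal_gen_mono _ (fun g : P => exists2 i, xpredT i & g = 'X_i ^+ 2)).
  by move=> g [i _ ->]; exists i.
by apply/square_idealP => k k1; apply: f0 => i; apply: k1.
Qed.

Lemma no_even_eulerian_gorenstein : eulerian_gorenstein K G.
Proof.
pose top : P := 'X_[edge_mnm E].
have topE i : edge_mnm E i = 1%N by rewrite mnmE enum_valP.
exists (eulerian_class top).
  apply/eqP => /eulerian_class0/eulerian_idealP/(_ (edge_mnm E)).
  rewrite mcoeffX eqxx => H; have /eqP := H (fun i => eq_leq (topE i)).
  by rewrite oner_eq0.
move=> v; have [f ->] := eulerian_class_surj v; rewrite socle_eulerian_class.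
split=> [If|[c Dc] i].
  exists f@_(edge_mnm E); rewrite -eulerian_classZ; apply/eulerian_class_eq.
  apply/eulerian_idealP => k k1; rewrite mcoeffB mcoeffZ mcoeffX.
  have [<-|nk] := eqVneq; first by rewrite mulr1 subrr.
  rewrite mulr0 subr0.
  (* A squarefree exponent other than the top one omits some [i]. It stays squarefree after
     multiplication by ['X_i], so membership of ['X_i * f] kills the coefficient. *)
  have [i ki0] : exists i, k i = 0%N.
    have /existsP[i /eqP ki] : [exists i, k i == 0%N]; last by exists i.
    apply: contraNT nk => /existsPn nk; apply/eqP/mnmP => i; rewrite topE.
    by have := nk i; have := k1 i; case: (k i) => [|[]].
  rewrite -(mcoeffMX f U_(i)) mulrC; apply: (eulerian_idealP _).1 (If i) _ _ => j.
  by rewrite mnmDE mnm1E; case: eqP => [<-|_]; rewrite ?ki0 ?k1.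
apply/eulerian_class0; rewrite eulerian_classM Dc -scalerAr -eulerian_classM.
suff /eulerian_class0-> : eulerian_ideal ('X_i * top) by rewrite scaler0.
rewrite -mpolyXD; apply: (@square_dvd_mpolyX _ _ _ i); last by right; exists i.
by rewrite mnmDE mnm1E eqxx topE.
Qed.

Lemma eulerian_complete_intersection : complete_intersection (@eulerian_ideal K G).
Proof.
exists [seq 'X_i ^+ 2 | i <- enum 'I_#|E|]; split.
- move=> f /mapP[i _ ->]; exists (mdeg (U_(i) + U_(i))%MM).
  by rewrite mpolyXU2 dhomogX.
- by apply: squares_regular_sequence; apply: enum_uniq.
move=> f; rewrite eulerian_ideal_squares; split; apply: ideal_gen_mono => g.
  by move=> [i ->]; apply: map_f; rewrite mem_enum.
by move=> /mapP[i _ ->]; exists i.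
Qed.

End NoEulerian.

Theorem theorem3p6 (K : fieldType) (G : sgraph)
    (bipG : bipartite G) (edgesG : edges G != set0) :
  (eulerian_gorenstein K G <-> ~ has_even_eulerian_subset G) /\
  (eulerian_gorenstein K G ->
    (forall f : {mpoly K[#|edges G|]},
       eulerian_ideal f <-> ideal_gen (@edge_square K G) f) /\
    complete_intersection (@eulerian_ideal K G)).
Proof.
split.
  by split; [apply: gorenstein_no_even_eulerian | apply: no_even_eulerian_gorenstein].
move=> /(gorenstein_no_even_eulerian bipG) noC; split.
  exact: eulerian_ideal_squares.
exact: eulerian_complete_intersection.
Qed.
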